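(* Let $Q$ be the vehicle capacity and let $S$ be any set of customers whose demands are given by independent negative binomial random variables $\xi_i\sim\mathrm{NB}(r_i,p)$, $i\in S$, sharing a common success probability $p$, with total expected value $\sum_{i\in S}r_i(1-p)/p\le Q$. Then $S$ respects the monotonicity condition.
   Context: There is a finite set of customers with independent random demands $\xi_i$, served by identical vehicles of capacity $Q>0$. Monotonicity condition: a set $S$ of customers respects the monotonicity condition (with respect to the capacity $Q$) if, for every pair $(a,b)\in S\times S$ with $a\ne b$ and every subset $\tilde S\subseteq S\setminus\{a,b\}$, the inequality $$\mathbb{P}\left(\tilde\xi+\xi_a\le lQ<\tilde\xi+\xi_a+\xi_b\right)\ \ge\ \mathbb{P}\left(\tilde\xi\le lQ<\tilde\xi+\xi_b\right),\qquad \tilde\xi=\sum_{i\in\tilde S}\xi_i,$$ holds for every positive integer $l$. $\mathrm{NB}(r,p)$ is the negative binomial distribution with parameter $r$ and success probability $p$, in the parametrization that counts the failures preceding the $r$-th success in independent trials with success probability $p$, so that its mean is $r(1-p)/p$.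
   Formalization: The capacity Q is taken to be a positive integer (demands are integer-valued); for non-integer real Q the claim fails, e.g. Q = 1.9, p = 10/11, r = 1, 1, 17, l = 1. *)

(* Defs.v *)
From HB Require Import structures.
From mathcomp Require Import all_boot all_order all_algebra.
From mathcomp Require Import all_classical all_reals all_analysis.

Set Implicit Arguments.
Unset Strict Implicit.
Unset Printing Implicit Defensive.

Import Order.TTheory GRing.Theory Num.Theory.

Local Open Scope classical_set_scope.
Local Open Scope ring_scope.

(* The r-th success is preceded by exactly k failures: the last of the k + r
   trials is a success, and the failures occupy k of the other k + r - 1. *)
Definition nbinomial_pmf (R : realType) (r : nat) (p : R) (k : nat) : R :=
  p ^+ r * (1 - p) ^+ k *+ 'C((k + r).-1, k).

(* For 0 < r and 0 < p <= 1 these masses sum to 1, so they determine the law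
   of X, which is then almost surely a natural number. *)
Definition has_nbinomial_law (d : measure_display) (T : measurableType d)
    (R : realType) (P : probability T R) (X : {RV P >-> R}) (r : nat) (p : R)
    : Prop :=
  forall k : nat, pmf X k%:R = nbinomial_pmf r p k.

Definition mutually_independent (d : measure_display) (T : measurableType d)
    (R : realType) (P : probability T R) (I : finType) (S : {set I})
    (X : I -> {RV P >-> R}) : Prop :=
  forall (J : {set I}) (B : I -> set R), J \subset S ->
    (forall i, i \in J -> measurable (B i)) ->
    P [set t | forall i, i \in J -> B i (X i t)] =
    (\prod_(i in J) P (X i @^-1` B i))%E.

Definition monotonicity_condition (d : measure_display) (T : measurableType d)
    (R : realType) (P : probability T R) (I : finType)
    (Q : R) (xi : I -> {RV P >-> R}) (S : {set I}) : Prop :=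
  forall a b : I, a \in S -> b \in S -> a != b ->
  forall S' : {set I}, S' \subset S :\: [set a; b]%SET ->
  forall l : nat, (0 < l)%N ->
  let txi t := \sum_(i in S') xi i t in
  (P [set t | (txi t + xi a t <= l%:R * Q < txi t + xi a t + xi b t)%R] >=
   P [set t | (txi t <= l%:R * Q < txi t + xi b t)%R])%E.

(* Main.v *)
(* Put n = lQ and F(m) = P(NB(m, p) <= n).  Sums of independent NB(r_i, p) are
   NB(sum of the r_i, p), so both sides of the inequality are differences
   F(m) - F(m + r_b), at m = s + r_a and at m = s, and the claim is that F is
   concave on the relevant range.  The decrement F(m) - F(m + 1) is the
   probability that exactly m successes precede the (n + 1)-st failure, namely
   C(n + m, m) p^m (1 - p)^(n + 1), whose ratio between m and m + 1 is
   (n + m + 1) p / (m + 1); this is at least 1 iff (m + 1) (1 - p) / p <= n,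
   which is what the bound on the total mean provides. *)
Require Import Defs.
From HB Require Import structures.
From mathcomp Require Import all_boot all_order all_algebra.
From mathcomp Require Import all_classical all_reals all_analysis.
From mathcomp Require Import ring.

Set Implicit Arguments.
Unset Strict Implicit.
Unset Printing Implicit Defensive.

Import Order.TTheory GRing.Theory Num.Theory.
Import numFieldNormedType.Exports.

Local Open Scope classical_set_scope.
Local Open Scope ring_scope.

(** * Mass function: recursion and convolution *)

Lemma nbinomial_pmf0 (R : realType) (p : R) (k : nat) :
  nbinomial_pmf 0 p k = (k == 0)%N%:R.
Proof.
rewrite /nbinomial_pmf addn0; case: k => [|k]; first by rewrite !expr0 mulr1.
by rewrite bin_small.
Qed.

Lemma nbinomial_pmf_ge0 (R : realType) (r : nat) (p : R) (k : nat) :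
  0 <= p -> p <= 1 -> 0 <= nbinomial_pmf r p k.
Proof.
by move=> p0 p1; rewrite mulrn_wge0// mulr_ge0// exprn_ge0// subr_ge0.
Qed.

Lemma nbinomial_pmfS0 (R : realType) (r : nat) (p : R) :
  nbinomial_pmf r.+1 p 0 = p * nbinomial_pmf r p 0.
Proof. by rewrite /nbinomial_pmf !bin0 !expr0 !mulr1n !mulr1 exprS. Qed.

(** Condition on the first trial: a success leaves [r] successes to wait for, a failure uses up one
    of the [k.+1] failures. Algebraically this is Pascal's rule. *)
Lemma nbinomial_pmfSS (R : realType) (r : nat) (p : R) (k : nat) :
  nbinomial_pmf r.+1 p k.+1 =
  p * nbinomial_pmf r p k.+1 + (1 - p) * nbinomial_pmf r.+1 p k.
Proof.
rewrite /nbinomial_pmf !addSn !addnS/= binS mulrnDr !mulrnAr !exprS.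
by congr (_ *+ _ + _ *+ _); ring.
Qed.

(** The first-trial recursion, applied on both sides, gives the identity by induction on [r] and
    then on [k]. *)
Lemma nbinomial_pmf_conv (R : realType) (r s : nat) (p : R) (k : nat) :
  \sum_(j < k.+1) nbinomial_pmf r p j * nbinomial_pmf s p (k - j) =
  nbinomial_pmf (r + s) p k.
Proof.
elim: r k => [|r IHr] k.
  rewrite big_ord_recl nbinomial_pmf0 mul1r subn0 big1 ?addr0// => i _.
  by rewrite nbinomial_pmf0 mul0r.
elim: k => [|k IHk].
  by rewrite big_ord1 addSn !nbinomial_pmfS0 -IHr big_ord1 mulrA.
rewrite addSn nbinomial_pmfSS -addSn -IHk -IHr !mulr_sumr.
rewrite big_ord_recl [in RHS]big_ord_recl -addrA -big_split/=; congr (_ + _).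
  by rewrite nbinomial_pmfS0 mulrA.
apply: eq_bigr => i _; rewrite /bump/= nbinomial_pmfSS subSS; ring.
Qed.

(** * Distribution function and its decrements in [r] *)

Definition nbinomial_cdf (R : realType) (r : nat) (p : R) (n : nat) : R :=
  \sum_(k < n.+1) nbinomial_pmf r p k.

(* The probability that exactly [r] successes precede the [n.+1]-st failure. *)
Definition nbinomial_step (R : realType) (r : nat) (p : R) (n : nat) : R :=
  p ^+ r * (1 - p) ^+ n.+1 *+ 'C(n + r, r).

Lemma nbinomial_cdfB (R : realType) (r : nat) (p : R) (n : nat) :
  nbinomial_cdf r p n - nbinomial_cdf r.+1 p n = nbinomial_step r p n.
Proof.
rewrite /nbinomial_cdf /nbinomial_step.
elim: n => [|n IHn].
  rewrite !big_ord1 nbinomial_pmfS0 /nbinomial_pmf bin0 add0n binn !mulr1n.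
  by ring.
rewrite big_ord_recr [X in _ - X]big_ord_recr/= opprD addrACA {}IHn.
(* [nbinomial_step] chooses the successes and [nbinomial_pmf] the failures; symmetry of the
   binomials aligns them for Pascal's rule. *)
have binE m : 'C(m + r, r) = 'C(m + r, m).
  by rewrite -[in RHS](bin_sub (leq_addr r m)) addKn.
rewrite nbinomial_pmfSS /nbinomial_pmf !binE addnS addSn/= binS.
by rewrite !exprS; ring.
Qed.

Lemma nbinomial_step_ge0 (R : realType) (r : nat) (p : R) (n : nat) :
  0 <= p -> p <= 1 -> 0 <= nbinomial_step r p n.
Proof.
by move=> p0 p1; rewrite mulrn_wge0// mulr_ge0// exprn_ge0// subr_ge0.
Qed.

Lemma nbinomial_stepS (R : realType) (r : nat) (p : R) (n : nat) :
  r.+1%:R * nbinomial_step r.+1 p n =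
  (n + r).+1%:R * p * nbinomial_step r p n.
Proof.
rewrite /nbinomial_step !addnS exprS.
transitivity (p * p ^+ r * (1 - p) ^+ n.+1 * (r.+1 * 'C((n + r).+1, r.+1))%:R).
  by rewrite natrM; ring.
by rewrite -mul_bin_diag natrM /=; ring.
Qed.

(** All consecutive ratios from [r] up to [s] are at least 1, since the mean bound at [s] passes to
    every smaller index. *)
Lemma nbinomial_step_le (R : realType) (r s : nat) (p : R) (n : nat) :
  0 < p -> p <= 1 -> (r <= s)%N -> s%:R * (1 - p) / p <= n%:R ->
  nbinomial_step r p n <= nbinomial_step s p n.
Proof.
move=> p0 p1 /subnKC <-; elim: (s - r)%N => [|m IHm]; first by rewrite addn0.
rewrite addnS; set t := (r + m)%N => tn.
have tn' : t.+1%:R * (1 - p) <= n%:R * p by rewrite -ler_pdivrMr.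
apply: (@le_trans _ _ (nbinomial_step t p n)).
  apply: IHm; rewrite ler_pdivrMr//; apply: le_trans tn'.
  by rewrite ler_wpM2r ?subr_ge0// ler_nat.
rewrite -(@ler_pM2l _ t.+1%:R)// nbinomial_stepS.
rewrite ler_wpM2r ?nbinomial_step_ge0 ?(ltW p0)//.
(* The claim [t.+1 <= (n + t.+1) * p] rearranges to [t.+1 * (1 - p) <= n * p]. *)
rewrite -addnS natrD mulrDl -lerBlDr; apply: le_trans tn'.

by rewrite mulrBr mulr1.
Qed.

Lemma nbinomial_cdf0 (R : realType) (p : R) (n : nat) :
  nbinomial_cdf 0 p n = 1.
Proof.
rewrite /nbinomial_cdf big_ord_recl nbinomial_pmf0 big1 ?addr0// => i _.
by rewrite nbinomial_pmf0.
Qed.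

Lemma nbinomial_cdf_subD (R : realType) (r s : nat) (p : R) (n : nat) :
  nbinomial_cdf r p n - nbinomial_cdf (r + s) p n =
  \sum_(i < s) nbinomial_step (r + i) p n.
Proof.
elim: s => [|s IHs]; first by rewrite addn0 subrr big_ord0.
by rewrite big_ord_recr/= -IHs -nbinomial_cdfB addnS addrA subrK.
Qed.

(** Both sides telescope into [b] decrements; the [i]-th ones sit at [r + i] and [r + a + i], and
    the latter index stays below [r + a + b]. *)
Lemma nbinomial_cdf_concave (R : realType) (r a b : nat) (p : R) (n : nat) :
  0 < p -> p <= 1 -> (r + a + b)%:R * (1 - p) / p <= n%:R ->
  nbinomial_cdf r p n - nbinomial_cdf (r + b) p n <=
  nbinomial_cdf (r + a) p n - nbinomial_cdf (r + a + b) p n.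
Proof.
move=> p0 p1 rab; rewrite !nbinomial_cdf_subD; apply: ler_sum => i _.
apply: nbinomial_step_le => //; first by rewrite leq_add2r leq_addr.
apply: le_trans rab; rewrite ler_pM2r ?invr_gt0// ler_wpM2r ?subr_ge0//.
by rewrite ler_nat leq_add2l ltnW.
Qed.

(** * Total mass *)

Lemma nbinomial_cdf_le1 (R : realType) (r : nat) (p : R) (n : nat) :
  0 <= p -> p <= 1 -> nbinomial_cdf r p n <= 1.
Proof.
move=> p0 p1; elim: r => [|r]; first by rewrite nbinomial_cdf0.
by apply: le_trans; rewrite -subr_ge0 nbinomial_cdfB nbinomial_step_ge0.
Qed.

(** The masses are the terms of a series whose partial sums are nondecreasing and bounded by 1. *)
Lemma nbinomial_pmf_cvg0 (R : realType) (r : nat) (p : R) :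
  0 <= p -> p <= 1 -> nbinomial_pmf r p @ \oo --> (0 : R).
Proof.
move=> p0 p1; apply: cvg_series_cvg_0; apply: nondecreasing_is_cvgn.
  by apply: nondecreasing_series => n _ _; exact: nbinomial_pmf_ge0.
exists 1 => _ [[|n] _ <-]; first by rewrite /series/= big_geq.
by rewrite /series/= big_mkord; exact: nbinomial_cdf_le1.
Qed.

(** Raising [r] by one lowers the distribution function by a constant multiple of a mass, which
    tends to 0, so the limit 1 at [r = 0] persists. *)
Lemma nbinomial_cdf_cvg1 (R : realType) (r : nat) (p : R) :
  0 < p -> p <= 1 -> nbinomial_cdf r p @ \oo --> (1 : R).
Proof.
move=> p0 p1; elim: r => [|r IHr].
  rewrite (_ : nbinomial_cdf 0 p = cst 1); first exact: cvg_cst.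
  by apply/funext => n; rewrite nbinomial_cdf0.
have stepE n : nbinomial_step r p n = (1 - p) / p * nbinomial_pmf r.+1 p n.
  have binE : 'C(n + r, r) = 'C(n + r, n).
    by rewrite -[in RHS](bin_sub (leq_addr r n)) addKn.
  rewrite /nbinomial_step /nbinomial_pmf addnS/= binE mulrnAr !exprS.
  by congr (_ *+ _); field; exact: lt0r_neq0.

have -> : nbinomial_cdf r.+1 p =
    nbinomial_cdf r p \- (fun n => (1 - p) / p * nbinomial_pmf r.+1 p n).
  by apply/funext => n /=; rewrite -stepE -nbinomial_cdfB subKr.
have cvg0 := nbinomial_pmf_cvg0 r.+1 (ltW p0) p1.
rewrite [X in _ --> X](_ : _ = 1 - (1 - p) / p * 0); last first.
  by rewrite mulr0 subr0.
by apply: (cvgB IHr); exact: (cvgM (cvg_cst _) cvg0).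
Qed.

(** * Almost sure integrality of the demands *)

Lemma ae_measure_eq (d : measure_display) (T : measurableType d)
    (R : realType) (mu : {measure set T -> \bar R}) (A B : set T) :
  measurable A -> measurable B -> {ae mu, forall t, A t <-> B t} ->
  mu A = mu B.
Proof.
move=> mA mB [N [mN N0 ABN]].
rewrite -(measureU0 mA mN N0) -(measureU0 mB mN N0); congr (mu _).
apply/seteqP; split=> t [] Ht; try by right.
  by have [/iffLR/(_ Ht)|/ABN] := pselect (A t <-> B t); [left|right].
by have [/iffRL/(_ Ht)|/ABN] := pselect (A t <-> B t); [left|right].
Qed.

Lemma has_nbinomial_lawE (d : measure_display) (T : measurableType d)
    (R : realType) (P : probability T R) (X : {RV P >-> R}) (r : nat) (p : R)
    (k : nat) :
  has_nbinomial_law X r p ->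
  P (X @^-1` [set k%:R]) = (nbinomial_pmf r p k)%:E.
Proof.
move=> /(_ k) <-; rewrite /pmf fineK//; apply: fin_num_measure.
exact: measurable_funPTI.
Qed.

(** The masses prescribed at the naturals already sum to 1, so nothing is left for their
    complement. *)
Lemma nbinomial_ae_nat (d : measure_display) (T : measurableType d)
    (R : realType) (P : probability T R) (X : {RV P >-> R}) (r : nat) (p : R) :
  0 < p -> p <= 1 -> has_nbinomial_law X r p ->
  {ae P, forall t, X t \is a Num.nat}.
Proof.
move=> p0 p1 lawX.
pose F (k : nat) : set T := X @^-1` [set k%:R].
have mF k : measurable (F k) by exact: measurable_funPTI.
have mA : measurable (\bigcup_k F k) by exact: bigcup_measurable.
have finA : P (\bigcup_k F k) \is a fin_num by exact: fin_num_measure.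
have tF : trivIset setT F.
  move=> i j _ _ [t [/= Xi Xj]]; apply/eqP.
  by rewrite -(eqr_nat R) -Xi -Xj.
have A1 : (1 <= P (\bigcup_k F k))%E.
  rewrite -(fineK finA) lee_fin -(cvg_lim _ (nbinomial_cdf_cvg1 r p0 p1))//.
  apply: limr_le; first by apply/cvg_ex; exists 1; exact: nbinomial_cdf_cvg1.
  (* Each partial sum is the probability of a finite union of the [F k]. *)
  near=> n; rewrite -lee_fin fineK// /nbinomial_cdf -sumEFin.
  under eq_bigr do rewrite -(has_nbinomial_lawE _ lawX).
  rewrite -(measure_bigsetU P mF tF).
  apply: le_measure; rewrite ?inE//; first exact: bigsetU_measurable.
  by rewrite -bigcup_mkord => t [k _ Fk]; exists k.
exists (~` \bigcup_k F k); split; first exact: measurableC.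
  rewrite [LHS]probability_setC//; apply/eqP; rewrite sube_eq ?add0e//.
  by rewrite eq_le A1 probability_le1.
by move=> t /= nX [k _ Fk]; apply: nX; rewrite Fk; exact: natr_nat.
Unshelve. all: by end_near. Qed.

Lemma nbinomial_ae_nat_fin (d : measure_display) (T : measurableType d)
    (R : realType) (P : probability T R) (I : finType) (S : {set I})
    (X : I -> {RV P >-> R}) (r : I -> nat) (p : R) :
  0 < p -> p <= 1 ->
  (forall i, i \in S -> has_nbinomial_law (X i) (r i) p) ->
  {ae P, forall t, forall i, i \in S -> X i t \is a Num.nat}.
Proof.
move=> p0 p1 lawX; apply: filter_forall => i.
have [iS|iS] := boolP (i \in S); last exact: aeW.
by apply: filterS (nbinomial_ae_nat p0 p1 (lawX i iS)).
Qed.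

(** * Laws of sums of demands *)

Lemma measurable_sum_preimage (d : measure_display) (T : measurableType d)
    (R : realType) (P : probability T R) (I : finType) (J : {set I})
    (X : I -> {RV P >-> R}) (B : set R) :
  measurable B -> measurable [set t | B (\sum_(i in J) X i t)].
Proof.
move=> mB; rewrite -[X in measurable X]setTI.
under eq_set do rewrite -big_enum.
exact: (@measurable_sum _ _ _ setT _ (enum J) (fun i => X i)).
Qed.

Lemma measurable_sum_le (d : measure_display) (T : measurableType d)
    (R : realType) (P : probability T R) (I : finType) (J : {set I})
    (X : I -> {RV P >-> R}) (x : R) :
  measurable [set t | \sum_(i in J) X i t <= x].
Proof.
have := measurable_sum_preimage J X (measurable_itv `]-oo, x]).
by rewrite set_itvNyc.
Qed.

Lemma measurable_sum_values (d : measure_display) (T : measurableType d)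
    (R : realType) (P : probability T R) (I : finType) (J K : {set I})
    (X : I -> {RV P >-> R}) (x : R) (g : I -> R) :
  measurable [set t | \sum_(i in J) X i t = x /\
                      forall i, i \in K -> X i t = g i].
Proof.
apply: measurableI.
  exact: (measurable_sum_preimage J X (measurable_set1 x)).
change (measurable (\bigcap_(i in [set` K]) (X i @^-1` [set g i]))).
apply: fin_bigcap_measurable => [|i _]; first exact: finite_finset.
exact: measurable_funPTI.
Qed.

(* Fixing the variables indexed by [K] lets independence be used one variable
   at a time: enlarging [J] by [c] is conditioning on the value of [X c]. *)
Lemma nbinomial_sum_joint (d : measure_display) (T : measurableType d)
    (R : realType) (P : probability T R) (I : finType) (S J K : {set I})
    (X : I -> {RV P >-> R}) (r : I -> nat) (p : R) (k : nat) (g : I -> nat) :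
  0 < p -> p <= 1 ->
  (forall i, i \in S -> has_nbinomial_law (X i) (r i) p) ->
  mutually_independent S X ->
  J \subset S -> K \subset S -> [disjoint J & K]%B ->
  P [set t | \sum_(i in J) X i t = k%:R /\
             forall i, i \in K -> X i t = (g i)%:R] =
  (nbinomial_pmf (\sum_(i in J) r i) p k *
   \prod_(i in K) nbinomial_pmf (r i) p (g i))%:E.
Proof.
move=> p0 p1 lawX indX.
(* [K] and [g] stay general because each step moves one index from [J] to [K]. *)
move Em : #|J| => m; elim: m => [|m IHm] in J Em K k g *.
  move: Em => /eqP; rewrite cards_eq0 => /eqP -> _ KS _.
  under eq_set do rewrite big_set0.
  rewrite big_set0 nbinomial_pmf0; case: k => [|k] /=.
    rewrite mul1r -prodEFin.
    transitivity (\prod_(i in K) P (X i @^-1` [set (g i)%:R]))%E.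
      rewrite -(indX K (fun i => [set (g i)%:R]))//.
      by congr (P _); apply/seteqP; split=> [t []|t].
    apply: eq_bigr => i iK.
    exact/has_nbinomial_lawE/lawX/(fintype.subsetP KS).
  rewrite mul0r -[RHS](measure0 P); congr (P _); rewrite -subset0 => t [/eqP].
  by rewrite eq_sym pnatr_eq0.
move=> JS KS JK.
have [c cJ] : exists c, c \in J by apply/card_gt0P; rewrite Em.
have cS := fintype.subsetP JS c cJ.
have cK : c \notin K by move: JK => /disjointFr ->.
pose h j i := if i == c then j else g i.
have hc j : h j c = j by rewrite /h eqxx.
have hK j i : i \in K -> h j i = g i.
  by rewrite /h; case: eqP cK => [->/negPf->|].
(* The subtraction [k - j] is truncated, but only the [j <= k] enter the union below. *)
pose F j := [set t | \sum_(i in (J :\ c)%SET) X i t = (k - j)%:R /\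
                     forall i, i \in (c |: K)%SET -> X i t = (h j i)%:R].
have mF j : measurable (F j) by exact: measurable_sum_values.
have tF : trivIset setT F.
  move=> i j _ _ [t [[_ /(_ c (setU11 _ _)) Xi] [_ /(_ c (setU11 _ _)) Xj]]].
  by apply/eqP; rewrite -(eqr_nat R); move: Xi Xj; rewrite !hc => <- <-.
have PF j : P (F j) = (nbinomial_pmf (r c) p j *
    nbinomial_pmf (\sum_(i in (J :\ c)%SET) r i) p (k - j) *
    \prod_(i in K) nbinomial_pmf (r i) p (g i))%:E.
  rewrite IHm.
  - rewrite big_setU1//= hc (eq_bigr (fun i => nbinomial_pmf (r i) p (g i))).
      by congr EFin; ring.
    by move=> i iK; rewrite hK.
  - by move: Em; rewrite (cardsD1 c) cJ => -[].
  - by exact: fintype.subset_trans (subD1set _ _) JS.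
  - by rewrite finset.subUset finset.sub1set cS.
  - rewrite finset.disjoints_subset; apply/fintype.subsetP => i.
    by rewrite !inE negb_or => /andP[-> /(disjointFr JK) ->].
(* Up to a null set all demands are naturals, so the event splits by the value of [X c]; the
   convolution then sums the pieces. *)
rewrite (@ae_measure_eq _ _ _ P _ (\big[setU/set0]_(j < k.+1) F j)).
- rewrite (measure_bigsetU P mF tF) (eq_bigr _ (fun (j : 'I_k.+1) _ => PF j)).
  by rewrite sumEFin -mulr_suml nbinomial_pmf_conv -big_setD1.
- exact: measurable_sum_values.
- exact: bigsetU_measurable.
apply: filterS (nbinomial_ae_nat_fin p0 p1 lawX) => t Xnat.
rewrite -bigcup_mkord; split.
  move=> [+ XK]; rewrite (big_setD1 c)//= => sumE.
  have /natrP[j Xj] := Xnat c cS.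
  have /natrP[j' Xj'] : \sum_(i in (J :\ c)%SET) X i t \is a Num.nat.
    by apply: rpred_sum => i /setD1P[_ /(fintype.subsetP JS)]; exact: Xnat.
  move: sumE; rewrite Xj Xj' -natrD => /eqP; rewrite eqr_nat => /eqP jk.
  exists j; first by rewrite /= ltnS -jk leq_addr.
  split; first by rewrite Xj' -jk addKn.
  by move=> i /setU1P[->|iK]; rewrite ?hc// hK//; exact: XK.
move=> [j /= jk [sumE XK]]; split.
  by rewrite (big_setD1 c)//= sumE XK ?setU11// hc -natrD subnKC.
by move=> i iK; rewrite XK ?setU1r// hK.
Qed.

Lemma nbinomial_sum_cdf (d : measure_display) (T : measurableType d)
    (R : realType) (P : probability T R) (I : finType) (S J : {set I})
    (X : I -> {RV P >-> R}) (r : I -> nat) (p : R) (n : nat) :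
  0 < p -> p <= 1 ->
  (forall i, i \in S -> has_nbinomial_law (X i) (r i) p) ->
  mutually_independent S X -> J \subset S ->
  P [set t | \sum_(i in J) X i t <= n%:R] =
  (nbinomial_cdf (\sum_(i in J) r i) p n)%:E.
Proof.
move=> p0 p1 lawX indX JS.
pose F (k : nat) := [set t | \sum_(i in J) X i t = k%:R].
have mF k : measurable (F k).
  exact: (measurable_sum_preimage J X (measurable_set1 _)).
have tF : trivIset setT F.
  move=> i j _ _ [t [/= Xi Xj]]; apply/eqP.
  by rewrite -(eqr_nat R) -Xi -Xj.
have PF k : P (F k) = (nbinomial_pmf (\sum_(i in J) r i) p k)%:E.
  (* With [K] empty nothing is fixed, and [g] is a dummy. *)
  have := nbinomial_sum_joint (K := finset.set0) k (fun=> 0%N)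
    p0 p1 lawX indX JS.
  rewrite big_set0 mulr1 => <-; rewrite ?finset.sub0set//; last first.
    by rewrite finset.disjoints_subset finset.setC0 finset.subsetT.
  congr (P _); apply/seteqP; split=> t /=; last by case.
  by split=> // i; rewrite inE.
rewrite (@ae_measure_eq _ _ _ P _ (\big[setU/set0]_(k < n.+1) F k)).
- rewrite (measure_bigsetU P mF tF) (eq_bigr _ (fun (k : 'I_n.+1) _ => PF k)).
  by rewrite sumEFin.
- exact: measurable_sum_le.
- exact: bigsetU_measurable.
apply: filterS (nbinomial_ae_nat_fin p0 p1 lawX) => t Xnat.
rewrite -bigcup_mkord; split=> [/=|[k /= kn ->]]; last by rewrite ler_nat -ltnS.
have /natrP[k Xk] : \sum_(i in J) X i t \is a Num.nat.
  by apply: rpred_sum => i /(fintype.subsetP JS); exact: Xnat.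
by rewrite Xk ler_nat => kn; exists k.
Qed.

(** * Straddling probabilities and the monotonicity inequality *)

(** The event is a difference [U] minus [V] of two sublevel events; [V] lies in [U] almost surely
    because [X b] is nonnegative, so the probabilities subtract. *)
Lemma nbinomial_sum_straddle (d : measure_display) (T : measurableType d)
    (R : realType) (P : probability T R) (I : finType) (S J : {set I})
    (X : I -> {RV P >-> R}) (r : I -> nat) (p : R) (n : nat) (b : I) :
  0 < p -> p <= 1 ->
  (forall i, i \in S -> has_nbinomial_law (X i) (r i) p) ->
  mutually_independent S X -> J \subset S -> b \in S -> b \notin J ->
  P [set t | \sum_(i in J) X i t <= n%:R < \sum_(i in J) X i t + X b t] =
  (nbinomial_cdf (\sum_(i in J) r i) p n -
   nbinomial_cdf (\sum_(i in J) r i + r b) p n)%:E.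
Proof.
move=> p0 p1 lawX indX JS bS bJ.
have bJS : (b |: J)%SET \subset S by rewrite finset.subUset finset.sub1set bS.
pose U := [set t | \sum_(i in J) X i t <= n%:R].
pose V := [set t | \sum_(i in (b |: J)%SET) X i t <= n%:R].
have mle K := measurable_sum_le K X n%:R.
have VE t : V t = (\sum_(i in J) X i t + X b t <= n%:R) :> Prop.
  by rewrite /V/= big_setU1//= addrC.
rewrite (_ : [set _ | _] = U `\` V); last first.
  apply/seteqP; split=> t /=; rewrite VE.
    by move=> /andP[Ut]; rewrite ltNge => /negP.
  by move=> [Ut] /negP; rewrite -ltNge => Vt; apply/andP.
rewrite measureD; [|exact: mle|exact: mle|]; last first.
  by rewrite ltey_eq fin_num_measure//; exact: mle.
transitivity (P U - P V)%E; last first.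
  by rewrite !(nbinomial_sum_cdf n p0 p1 lawX indX)// big_setU1//= addnC EFinB.
congr (_ - _)%E; apply: ae_measure_eq.
- by apply: measurableI; exact: mle.
- exact: mle.
apply: filterS (nbinomial_ae_nat_fin p0 p1 lawX) => t Xnat.
split=> [[]//|Vt]; split=> //; move: Vt; rewrite VE /U/=.
by apply: le_trans; rewrite lerDl natr_ge0// Xnat.
Qed.

Theorem proposition8 (d : measure_display) (T : measurableType d)
    (R : realType) (P : probability T R) (I : finType) (S : {set I})
    (xi : I -> {RV P >-> R}) (Q : nat) (r : I -> nat) (p : R)
    (Q_gt0 : (0 < Q)%N)
    (p_gt0 : 0 < p) (p_le1 : p <= 1)
    (r_gt0 : forall i, i \in S -> (0 < r i)%N)
    (xi_nbinomial : forall i, i \in S -> has_nbinomial_law (xi i) (r i) p)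
    (xi_indep : mutually_independent S xi)
    (mean_le : \sum_(i in S) (r i)%:R * (1 - p) / p <= Q%:R) :
  monotonicity_condition Q%:R xi S.
Proof.
move=> a b aS bS ab S' S'Sab l l_gt0 /=.
have S'S : S' \subset S := fintype.subset_trans S'Sab (subsetDl _ _).
have aS' : a \notin S'.
  by apply/negP => /(fintype.subsetP S'Sab); rewrite !inE eqxx.
have bS' : b \notin S'.
  by apply/negP => /(fintype.subsetP S'Sab); rewrite !inE eqxx orbT.
have ba : b \notin (a |: S')%SET by rewrite in_setU1 eq_sym (negbTE ab).
have aS'S : (a |: S')%SET \subset S by rewrite finset.subUset finset.sub1set aS.
have sumE t : \sum_(i in S') xi i t + xi a t = \sum_(i in (a |: S')%SET) xi i t.
  by rewrite big_setU1//= addrC.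
under [X in (_ <= P X)%E]eq_set do rewrite sumE.
(* Both events straddle [n = l * Q], with [J] equal to [S'] and to [S'] enlarged by [a]. *)
rewrite -natrM !(nbinomial_sum_straddle _ p_gt0 p_le1 xi_nbinomial)//.
rewrite lee_fin big_setU1//= [(r a + _)%N]addnC.
(* As [0 < l], it suffices to bound the mean by [Q]. *)
apply: nbinomial_cdf_concave => //; apply: (@le_trans _ _ Q%:R); last first.
  by rewrite ler_nat leq_pmull.
apply: le_trans mean_le; rewrite -!mulr_suml -natr_sum.
rewrite ler_pM2r ?invr_gt0// ler_wpM2r ?subr_ge0// ler_nat.
have babS : (b |: (a |: S'))%SET \subset S.
  by rewrite finset.subUset finset.sub1set bS.
(* The parameters of [S'], [a] and [b] form part of the sum over [S]; the remaining terms are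
   nonnegative. *)
rewrite [leqRHS](big_setID (b |: (a |: S'))%SET)/= (finset.setIidPr babS).
by rewrite !big_setU1//= [leqLHS]addnC [(_ + r a)%N]addnC leq_addr.
Qed.
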